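(* Let $k\ge1$. The probability generating function $G_{V(k)}(s)=\sum_{v\ge 0}P(V(k)=v)s^v$ of $V(k)$ is given (as a formal power series in $s$) by $$G_{V(k)}(s)=\frac{s^kp^k}{1-q\sum_{i=1}^k p^{i-1}s^i}=\frac{s^kp^k-p^{k+1}s^{k+1}}{1-s+p^kq\,s^{k+1}}.$$
   Context: $(X_i)_{i\ge1}$ is an infinite sequence of independent Bernoulli trials with $P(X_i=1)=p$, $0<p<1$, and $P(X_i=0)=q=1-p$. For a positive integer $k$, $V(k)=\min\{n\ge k: X_{n-k+1}=\cdots=X_n=1\}$ is the waiting time until $k$ consecutive ones first occur. *)

(* Defs.v *)
From HB Require Import structures.
From mathcomp Require Import all_boot all_order all_algebra.
From mathcomp Require Import finmap.
From mathcomp Require Import all_classical all_reals all_analysis.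

Set Implicit Arguments.
Unset Strict Implicit.
Unset Printing Implicit Defensive.

Import Order.TTheory GRing.Theory Num.Theory.

Local Open Scope classical_set_scope.
Local Open Scope ring_scope.

(** Formal power series over [R].
    A formal power series is its sequence of coefficients; the record keeps
    its ring structure (Cauchy product) apart from the pointwise ring structure
    that MathComp-Analysis puts on [nat -> R]. *)

Record fps (R : Type) := Fps { fps_coef : nat -> R }.

HB.instance Definition _ (R : Type) := [isNew for @fps_coef R].

HB.instance Definition _ (R : choiceType) := [Choice of fps R by <:].

Lemma fpsP (R : Type) (f g : fps R) :
  (forall n, fps_coef f n = fps_coef g n) <-> f = g.
Proof.
split=> [|-> //]; case: f g => [f] [g] /= fg.
by congr Fps; apply/funext.
Qed.

Section FpsZmodule.
Variable R : zmodType.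
Implicit Types f g h : fps R.

Definition fps_zero : fps R := Fps (fun=> 0).
Definition fps_opp f : fps R := Fps (fun n => - fps_coef f n).
Definition fps_add f g : fps R := Fps (fun n => fps_coef f n + fps_coef g n).

Lemma fps_addA : associative fps_add.
Proof. by move=> f g h; apply/fpsP => n /=; rewrite addrA. Qed.

Lemma fps_addC : commutative fps_add.
Proof. by move=> f g; apply/fpsP => n /=; rewrite addrC. Qed.

Lemma fps_add0 : left_id fps_zero fps_add.
Proof. by move=> f; apply/fpsP => n /=; rewrite add0r. Qed.

Lemma fps_addN : left_inverse fps_zero fps_opp fps_add.
Proof. by move=> f; apply/fpsP => n /=; rewrite addNr. Qed.

HB.instance Definition _ := GRing.isZmodule.Build (fps R)
  fps_addA fps_addC fps_add0 fps_addN.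

End FpsZmodule.

Section FpsRing.
Variable R : comNzRingType.
Implicit Types f g h : fps R.

Definition fps_one : fps R := Fps (fun n => (n == 0%N)%:R).
Definition fps_mul f g : fps R :=
  Fps (fun n => \sum_(i < n.+1) fps_coef f i * fps_coef g (n - i)%N).

Let trunc N f : {poly R} := \poly_(i < N) fps_coef f i.

Let coef_trunc N f n : (n < N)%N -> (trunc N f)`_n = fps_coef f n.
Proof. by move=> nN; rewrite coef_poly nN. Qed.

Let coef_trunc_mul N f g n : (n < N)%N ->
  fps_coef (fps_mul f g) n = (trunc N f * trunc N g)`_n.
Proof.
move=> nN; rewrite coefM /=; apply: eq_bigr => i _.
rewrite !coef_trunc //; first exact: leq_ltn_trans (leq_subr _ _) nN.
by apply: leq_ltn_trans nN; rewrite -ltnS.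
Qed.

Lemma fps_mulC : commutative fps_mul.
Proof.
by move=> f g; apply/fpsP => n; rewrite !(@coef_trunc_mul n.+1)// mulrC.
Qed.

Lemma fps_mulA : associative fps_mul.
Proof.
move=> f g h; apply/fpsP => n.
have lt_i (i : 'I_n.+1) : (i < n.+1)%N by [].
have lt_ni (i : 'I_n.+1) : (n - i < n.+1)%N by rewrite ltnS leq_subr.
transitivity ((trunc n.+1 f * (trunc n.+1 g * trunc n.+1 h))`_n).
  rewrite coefM; apply: eq_bigr => i _.
  by rewrite coef_trunc// (@coef_trunc_mul n.+1).
rewrite mulrA coefM; apply: eq_bigr => i _.
by rewrite [(trunc _ h)`_ _]coef_trunc// (@coef_trunc_mul n.+1).
Qed.

Lemma fps_mul1 : left_id fps_one fps_mul.
Proof.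
move=> f; apply/fpsP => n /=.
rewrite big_ord_recl /= mul1r subn0 big1 ?addr0// => i _.
by rewrite /bump /= mul0r.
Qed.

Lemma fps_mulDl : left_distributive fps_mul +%R.
Proof.
move=> f g h; apply/fpsP => n /=.
by rewrite -big_split; apply: eq_bigr => i _; rewrite mulrDl.
Qed.

Lemma fps_oner_neq0 : fps_one != 0.
Proof.
apply/eqP => /(congr1 (fun f => fps_coef f 0%N)) /= /eqP.
by rewrite oner_eq0.
Qed.

HB.instance Definition _ := GRing.Zmodule_isComNzRing.Build (fps R)
  fps_mulA fps_mulC fps_mul1 fps_mulDl fps_oner_neq0.

Definition fps_of_poly (a : {poly R}) : fps R := Fps (fun n => a`_n).

Lemma fps_of_poly_is_zmod_morphism : zmod_morphism fps_of_poly.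
Proof. by move=> a b; apply/fpsP => n /=; rewrite coefB. Qed.

Lemma fps_of_poly_is_monoid_morphism : monoid_morphism fps_of_poly.
Proof.
split=> [|a b]; apply/fpsP => n /=; first by rewrite coef1.
by rewrite coefM.
Qed.

HB.instance Definition _ := GRing.isZmodMorphism.Build {poly R} (fps R)
  fps_of_poly fps_of_poly_is_zmod_morphism.
HB.instance Definition _ := GRing.isMonoidMorphism.Build {poly R} (fps R)
  fps_of_poly fps_of_poly_is_monoid_morphism.

End FpsRing.

Section FpsUnitRing.
Variable R : comUnitRingType.
Implicit Types f g : fps R.

(** The first [n] coefficients of [1 / f], from the recurrence
    [f_0 g_n = (n == 0) - \sum_(i < n) f_(n - i) g_i]. *)
Fixpoint fps_inv_seq f n : seq R :=
  if n is m.+1 then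
    let s := fps_inv_seq f m in
    rcons s ((fps_coef f 0)^-1 *
             ((m == 0%N)%:R - \sum_(i < m) fps_coef f (m - i)%N * s`_i))
  else [::].

Definition fps_unit : {pred fps R} :=
  [pred f : fps R | fps_coef f 0 \is a GRing.unit].

(** As usual for [GRing.inv], a non-invertible series is its own inverse. *)
Definition fps_inv f : fps R :=
  if f \in fps_unit then Fps (fun n => (fps_inv_seq f n.+1)`_n) else f.

Let size_inv_seq f n : size (fps_inv_seq f n) = n.
Proof. by elim: n => //= n IH; rewrite size_rcons IH. Qed.

Let nth_inv_seq f n i : (i < n)%N ->
  (fps_inv_seq f n)`_i = (fps_inv_seq f i.+1)`_i.
Proof.
elim: n => // n IH; rewrite ltnS leq_eqVlt => /predU1P[-> //|lt_in].
by rewrite [fps_inv_seq f n.+1]/= nth_rcons size_inv_seq lt_in IH.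
Qed.

Lemma fps_mulVf : {in fps_unit, left_inverse 1 fps_inv *%R}.
Proof.
move=> f fU; have f0U : fps_coef f 0 \is a GRing.unit by [].
rewrite /fps_inv fU; apply/fpsP => n /=.
rewrite big_ord_recr /= subnn nth_rcons size_inv_seq ltnn eqxx.
rewrite mulrC mulVKr// addrC -[RHS]addr0 -addrA; congr (_ + _).
rewrite addrC; apply/eqP; rewrite subr_eq0; apply/eqP; apply: eq_bigr => i _.
by rewrite mulrC nth_inv_seq.
Qed.

Lemma fps_unitPl f g : g * f = 1 -> fps_unit f.
Proof.
move=> /(congr1 (fun h => fps_coef h 0%N)) /=.
rewrite big_ord1 subn0 /= => gf1; apply/unitrP; exists (fps_coef g 0).
by split; [|rewrite mulrC]; exact: gf1.
Qed.

Lemma fps_inv_out : {in [predC fps_unit], fps_inv =1 id}.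
Proof. by move=> f /negbTE fNU; rewrite /fps_inv fNU. Qed.

HB.instance Definition _ := GRing.ComNzRing_hasMulInverse.Build (fps R)
  fps_mulVf fps_unitPl fps_inv_out.

Lemma fps_unitE f :
  (f \is a GRing.unit) = (fps_coef f 0 \is a GRing.unit).
Proof. by []. Qed.

End FpsUnitRing.

(** Mutual independence of the random variables [X i], [i \in A]. *)
Definition independent_RVs d (T : measurableType d) (R : realType)
    (P : probability T R) (A : set nat) (X : nat -> {RV P >-> R}) : Prop :=
  forall J : {fset nat}, [set` J] `<=` A ->
  forall B : nat -> set R, (forall i, measurable (B i)) ->
    P (\bigcap_(i in [set` J]) X i @^-1` B i) =
    (\prod_(i <- J) P (X i @^-1` B i))%E.

(** The least natural number satisfying [Q], [None] if there is none. *)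
Definition least (Q : nat -> Prop) : option nat :=
  match pselect (exists n, `[< Q n >]) with
  | left exQ => Some (ex_minn exQ)
  | right _ => None
  end.

Lemma leastP (Q : nat -> Prop) n :
  least Q = Some n <-> Q n /\ (forall m, Q m -> (n <= m)%N).
Proof.
rewrite /least; case: pselect => [exQ|nexQ]; last first.
  by split=> // -[Qn _]; case: nexQ; exists n; apply/asboolP.
case: ex_minnP => m /asboolP Qm minm; split=> [[<-]|[Qn minn]].
  by split=> // i Qi; apply: minm; apply/asboolP.
congr Some; apply/eqP; rewrite eqn_leq minn// andbT.
by apply: minm; apply/asboolP.
Qed.

(** [V(k)]; [None] stands for the value [+oo], taken on the outcomes where [k]
    consecutive ones never occur. The trials are [X 1, X 2, ...]; [X 0] is
    not used. *)
Definition waiting_time (T : Type) (R : realType) (X : nat -> T -> R) (k : nat)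
    (w : T) : option nat :=
  least (fun n => (k <= n)%N /\
                  forall i, (n - k + 1 <= i <= n)%N -> X i w = 1).

Definition pgf d (T : measurableType d) (R : realType) (P : probability T R)
    (V : T -> option nat) : fps R :=
  Fps (fun v => fine (P [set w | V w = Some v])).

(* Main.v *)
Require Import Defs.
From mathcomp Require Import all_boot all_order all_algebra finmap zify ring.
From mathcomp Require Import all_classical all_reals all_analysis.

Set Implicit Arguments.
Unset Strict Implicit.
Unset Printing Implicit Defensive.

Import Order.TTheory GRing.Theory Num.Theory.

Local Open Scope classical_set_scope.
Local Open Scope ring_scope.

(* With [f n = P(V = n)] and [S n = P(V > n)], the first run of ones ends at
   time [n + k + 1] iff none ends by time [n], trial [n + 1] fails and the next
   [k] trials succeed, so [f (n + k + 1) = S n * q * p ^ k]. Differencing,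
   with [f (n + 1) = S n - S (n + 1)], gives a recurrence that says exactly
   [G * (1 - s + p ^ k q s ^ (k + 1)) = p ^ k s ^ k - p ^ (k + 1) s ^ (k + 1)].
   The other form of the quotient follows by cancelling [1 - p s]. *)

(** * Conditions on the first trials *)

Definition depends_on_first (m : nat) (g : set (nat -> bool)) : Prop :=
  forall x y, (forall i, (1 <= i <= m)%N -> x i = y i) -> g x -> g y.

Definition successes (T : Type) (R : realType) (X : nat -> T -> R) (w : T)
    (i : nat) : bool :=
  X i w == 1.

(** Freezing trial [m.+1] turns a condition on the first [m.+1] trials into one on the first [m],
    which drives the inductions on [m] below. *)
Definition fix_trial (m : nat) (b : bool) (x : nat -> bool) : nat -> bool :=
  fun i => if i == m then b else x i.

Lemma fix_trial_id m x : fix_trial m (x m) x = x.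
Proof. by apply/funext => i; rewrite /fix_trial; case: eqP => // ->. Qed.

Lemma depends_on_first_fix m b g : depends_on_first m.+1 g ->
  depends_on_first m (fix_trial m.+1 b @^-1` g).
Proof.
move=> gm x y xy; apply: gm => i im; rewrite /fix_trial.
by case: eqP => // /eqP im1; apply: xy; lia.
Qed.

(** * Independence of past and future trials *)

Section Independence.
Context d (T : measurableType d) (R : realType) (P : probability T R).
Variable X : nat -> {RV P >-> R}.

Let window (m n : nat) (B : nat -> set R) : set T :=
  \bigcap_(i in [set i | (m < i <= n)%N]) X i @^-1` B i.

(** Splitting on whether trial [m.+1] is a one leaves two events of the first [m] trials, each cut
    by [E] or its complement. *)
Lemma measurable_successes m g : depends_on_first m g ->
  measurable (successes X @^-1` g).
Proof.
elim: m g => [|m IH] g gm.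
  (* With [m = 0] the condition is constant, so its value at any one sequence decides it. *)
  have [g0|g0] := pselect (g xpred0).
    rewrite (_ : _ @^-1` _ = setT)//; apply/seteqP; split=> // w _.
    by apply: gm g0 => i; lia.
  rewrite (_ : _ @^-1` _ = set0)//; apply/seteqP; split=> // w gw.
  by apply: g0; apply: gm gw => i; lia.
pose E := X m.+1 @^-1` [set 1].
have mE : measurable E by exact: measurable_funPTI.
pose A b := successes X @^-1` (fix_trial m.+1 b @^-1` g).
have mA b : measurable (A b) by apply: IH; exact: depends_on_first_fix.
rewrite (_ : _ @^-1` _ = (A true `&` E) `|` (A false `\` E)); last first.
  have AE w b : (X m.+1 w == 1) = b -> A b w = g (successes X w).
    by move=> <-; rewrite /A /= fix_trial_id.
  apply/seteqP; split=> [w gw|w [[Aw Ew]|[Aw /eqP/negbTE Ew]]].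
  - have [Ew|/eqP Ew] := eqVneq (X m.+1 w) 1.
      by left; split=> //; rewrite AE//; exact/eqP.
    by right; split=> //; rewrite AE//; exact/eqP.
  - by rewrite /= -(AE _ true)//; exact/eqP.
  - by rewrite /= -(AE _ false).
by apply: measurableU; [exact: measurableI|exact: measurableD].
Qed.

Hypothesis Xindep : independent_RVs [set i | (1 <= i)%N] X.

Lemma measurable_window m n B : (forall i, measurable (B i)) ->
  measurable (window m n B).
Proof.
by move=> mB; apply: bigcap_measurableType => i _; exact: measurable_funPTI.
Qed.

Lemma probability_window n B : (forall i, measurable (B i)) ->
  fine (P (window 0 n B)) = \prod_(1 <= i < n.+1) fine (P (X i @^-1` B i)).
Proof.
move=> mB; pose J := [fset i in index_iota 1 n.+1]%fset.
have Jn : [set` J] = [set i | (0 < i <= n)%N].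
  by apply/seteqP; split=> i /=; rewrite inE mem_index_iota.
have := @Xindep J; rewrite {1}Jn => /(_ _ B mB); rewrite Jn => -> ; last first.
  by move=> i /andP[].
have -> : (\prod_(i <- J) P (X i @^-1` B i) =
    \prod_(i <- J) (fine (P (X i @^-1` B i)))%:E)%E.
  apply: eq_bigr => i _; rewrite fineK// fin_num_measure//.
  exact: measurable_funPTI.
rewrite prodEFin /=; apply: perm_big; apply: uniq_perm.
- exact: fset_uniq.
- exact: iota_uniq.
- by move=> i; rewrite inE.
Qed.

(* Conditioning on the last trial of the past and absorbing it into the future
   reduces [m.+1] to [m]. *)
Lemma probability_past_future m n g B : (m <= n)%N ->
  depends_on_first m g -> (forall i, measurable (B i)) ->
  fine (P (successes X @^-1` g `&` window m n B)) =
  fine (P (successes X @^-1` g)) *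
  \prod_(m.+1 <= i < n.+1) fine (P (X i @^-1` B i)).
Proof.
elim: m n g B => [|m IH] n g B mn gm mB.
  have [g0|g0] := pselect (g xpred0).
    rewrite (_ : _ @^-1` g = setT); last first.
      by apply/seteqP; split=> // w _; apply: gm g0 => i; lia.
    by rewrite setTI probability_setT /= mul1r probability_window.
  rewrite (_ : _ @^-1` g = set0); last first.
    apply/seteqP; split=> // w gw.
    by apply: g0; apply: gm gw => i; lia.
  by rewrite set0I measure0 mul0r.
pose A b := successes X @^-1` (fix_trial m.+1 b @^-1` g).
(* On [X m.+1 \in S] the Boolean value of trial [m.+1] is known to be [b]. So [g] may be replaced by
   its frozen version, and [S] becomes the constraint at time [m.+1] of a window starting after [m],
   where the induction hypothesis applies. *)
have step N b S : (m < N)%N -> measurable S ->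
    (forall r : R, S r -> (r == 1) = b) ->
    fine (P (successes X @^-1` g `&` window m.+1 N B `&` X m.+1 @^-1` S)) =
    fine (P (A b)) * fine (P (X m.+1 @^-1` S)) *
    \prod_(m.+2 <= i < N.+1) fine (P (X i @^-1` B i)).
  move=> mN mS Sb; pose B' i := if i == m.+1 then S else B i.
  have -> : successes X @^-1` g `&` window m.+1 N B `&` X m.+1 @^-1` S =
      A b `&` window m N B'.
    have AE w : S (X m.+1 w) -> A b w = g (successes X w).
      by move=> /Sb <-; rewrite /A /= fix_trial_id.
    apply/seteqP; split=> [w [[gw Bw] Sw]|w [Aw Bw]].
      split; first by rewrite AE.
      move=> i /= im; rewrite /B'; case: eqP => [->//|/eqP im1].
      by apply: Bw => /=; lia.
    have Sw : S (X m.+1 w).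
      by have := Bw m.+1; rewrite /B' /= eqxx; apply; lia.
    split=> //; split; first by rewrite /= -AE.
    move=> i /= im; have := Bw i; rewrite /B' /=.
    by case: eqP => [|_]; [lia|apply; lia].
  rewrite IH//; last 2 first.
  - exact: depends_on_first_fix.
  - by move=> i; rewrite /B'; case: ifP.
  - rewrite big_ltn// -mulrA /B' eqxx; congr (_ * (_ * _)).
    by apply: eq_big_nat => i im; case: eqP => // ?; lia.
  - exact: ltnW.
have mA := measurable_successes gm.
have split1 N : (m < N)%N ->
    fine (P (successes X @^-1` g `&` window m.+1 N B)) =
    (fine (P (A false)) * fine (P (X m.+1 @^-1` (~` [set 1]))) +
     fine (P (A true)) * fine (P (X m.+1 @^-1` [set 1]))) *
    \prod_(m.+2 <= i < N.+1) fine (P (X i @^-1` B i)).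
  move=> mN; have mAW : measurable (successes X @^-1` g `&` window m.+1 N B).
    by apply: measurableI => //; exact: measurable_window.
  have m1 S : measurable S -> measurable (X m.+1 @^-1` S).
    exact: measurable_funPTI.
  rewrite (measureDI _ mAW (m1 [set 1] _))// setDE preimage_setC fineD.
  - rewrite mulrDl (step N false (~` [set 1]))// ?(step N true)//.
    + by move=> r /= ->; rewrite eqxx.
    + exact: measurableC.
    + by move=> r r1; apply/negbTE/eqP.
  - rewrite fin_num_measure//; apply: measurableI => //; apply: m1.
    exact: measurableC.
  - by rewrite fin_num_measure//; apply: measurableI => //; exact: m1.
rewrite split1//; congr (_ * _).
(* For [N = m.+1] the window and the product are empty, which identifies the common factor as the
   probability of [g]. *)
have := split1 _ (ltnSn m); rewrite big_geq// mulr1 => <-; congr (fine (P _)).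
apply/seteqP; split=> w; first by case.
by move=> gw; split=> // i /=; lia.
Qed.

End Independence.

(** * Runs of ones and the waiting time *)

Definition success_run (k n : nat) : set (nat -> bool) :=
  [set x | (k <= n)%N /\ forall i, (n - k + 1 <= i <= n)%N -> x i].

(** Pulled back along [successes X], this is the event [V(k) > n], including the outcomes with
    infinite waiting time. *)
Definition no_run (k n : nat) : set (nat -> bool) :=
  [set x | forall m, (m <= n)%N -> ~ success_run k m x].

Lemma depends_on_first_no_run k n : depends_on_first n (no_run k n).
Proof.
move=> x y xy nx m mn [km my]; apply: (nx m mn); split=> // i im.
by rewrite xy ?my//; lia.
Qed.

Lemma waiting_timeP (T : Type) (R : realType) (X : nat -> T -> R) k n w :
  waiting_time X k w = Some n <->
  success_run k n (successes X w) /\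
  forall m, success_run k m (successes X w) -> (n <= m)%N.
Proof.
have runE m : ((k <= m)%N /\ forall i, (m - k + 1 <= i <= m)%N -> X i w = 1) <->
    success_run k m (successes X w).
  by split=> -[km Xm]; split=> // i im; apply/eqP; exact: Xm.
rewrite leastP runE; split=> -[nP minn]; split=> // m mP; apply: minn.
  exact/runE.
exact/runE.
Qed.

(** * Distribution of the waiting time *)

Section WaitingTime.
Context d (T : measurableType d) (R : realType) (P : probability T R).
Variables (X : nat -> {RV P >-> R}) (k : nat).
Hypothesis k_gt0 : (0 < k)%N.

Let pmf (n : nat) : R := fine (P [set w | waiting_time X k w = Some n]).
Let survival (n : nat) : R := fine (P (successes X @^-1` no_run k n)).

Lemma pmf_lt n : (n < k)%N -> pmf n = 0.
Proof.
move=> nk; rewrite /pmf (_ : [set _ | _] = set0) ?measure0//.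
by apply/seteqP; split=> // w /waiting_timeP[[]]; lia.
Qed.

(** Positivity of [k] matters: an empty run would already end at time 0. *)
Lemma survival0 : survival 0 = 1.
Proof.
rewrite /survival (_ : _ @^-1` _ = setT) ?probability_setT//.
by apply/seteqP; split=> // w _ m m0 []; lia.
Qed.

Lemma pmfS n : pmf n.+1 = survival n - survival n.+1.
Proof.
have mS m : measurable (successes X @^-1` no_run k m).
  by apply: measurable_successes; exact: depends_on_first_no_run.
have finS m : P (successes X @^-1` no_run k m) \is a fin_num.
  by rewrite fin_num_measure.
rewrite /pmf /survival -fineB//; congr fine.
have sub : successes X @^-1` no_run k n.+1 `<=` successes X @^-1` no_run k n.
  by move=> w nw m mn; apply: nw; exact: leqW.
rewrite -[in RHS](setIidr sub) -measureD//; last by rewrite ltey_eq finS.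
congr (P _); apply/seteqP; split=> w.
  move=> /waiting_timeP[rn minn]; split; last by move=> /(_ n.+1); apply.
  by move=> m mn /minn; lia.
move=> [nn nn1]; apply/waiting_timeP.
have rn m : success_run k m (successes X w) -> (n < m)%N.
  by move=> rm; rewrite ltnNge; apply/negP => /nn.
split=> //; apply: contrapT => nrn; apply: nn1 => m.
by rewrite leq_eqVlt => /predU1P[->//|/nn].
Qed.

Variable p : R.
Hypothesis Xp : forall i, (1 <= i)%N -> P [set w | X i w = 1] = p%:E.
Hypothesis Xindep : independent_RVs [set i | (1 <= i)%N] X.

(** No run can end before time [k], so [V(k) = k] only says that the first [k] trials are ones; the
    past is trivial because [survival 0 = 1]. *)
Lemma pmf_min : pmf k = p ^+ k.
Proof.
have := @probability_past_future _ _ _ _ _ Xindep 0 k (no_run k 0)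
  (fun=> [set 1]) (leq0n _) (@depends_on_first_no_run _ _)
  (fun=> measurable_set1 _).
rewrite -/(survival 0) survival0 mul1r => PE.
rewrite /pmf; transitivity (\prod_(1 <= i < k.+1) p); last first.
  by rewrite prodr_const_nat subn1.
have -> : \prod_(1 <= i < k.+1) p =
    \prod_(1 <= i < k.+1) fine (P (X i @^-1` [set 1])).
  by apply: eq_big_nat => i /andP[i0 _]; rewrite [P _]Xp.
rewrite -PE; congr (fine (P _)); apply/seteqP; split=> w.
  move=> /waiting_timeP[[_ wk] _]; split; first by move=> m m0 []; lia.
  by move=> i /= ik; apply/eqP; apply: wk; lia.
move=> [_ wk]; apply/waiting_timeP; split; last by move=> m [].
by split=> // i ik; apply/eqP; apply: wk => /=; lia.
Qed.

Lemma pmf_after n : pmf (n + k.+1) = survival n * ((1 - p) * p ^+ k).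
Proof.
(* The pattern after time [n]: a failure at [n.+1], then ones. *)
pose B i : set R := if i == n.+1 then ~` [set 1] else [set 1].
have mB i : measurable (B i).
  by rewrite /B; case: ifP => // _; exact: measurableC.
have := @probability_past_future _ _ _ _ _ Xindep n (n + k.+1) (no_run k n) B
  (leq_addr _ _) (@depends_on_first_no_run _ _) mB.
rewrite -/(survival n) big_ltn; last by lia.
have -> : fine (P (X n.+1 @^-1` B n.+1)) = 1 - p.
  by rewrite /B eqxx -preimage_setC probability_setC ?[P (_ @^-1` _)]Xp.
have -> : \prod_(n.+2 <= i < (n + k.+1).+1) fine (P (X i @^-1` B i)) = p ^+ k.
  transitivity (\prod_(n.+2 <= i < (n + k.+1).+1) p).
    apply: eq_big_nat => i im; rewrite /B; case: eqP => [|_]; first by lia.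
    by rewrite [P _]Xp//; lia.
  by rewrite prodr_const_nat; congr (_ ^+ _); lia.
move=> <-; congr (fine (P _)); apply/seteqP; split=> w.
  move=> /waiting_timeP[[_ wn] minn]; split.
    by move=> m mn /minn; lia.
  move=> i /= im; rewrite /B; case: eqP => [->|im1]; last first.
    by apply/eqP; apply: wn; lia.
  (* A success at [n.+1] would complete a run already at time [n + k]. *)
  move=> /= /eqP Xn1; suff /minn : success_run k (n + k) (successes X w) by lia.
  split=> [|i' i'n]; first by lia.
  have [->//|i'n1] := eqVneq i' n.+1.
  by apply: wn; lia.
move=> [nn Bw].
have fail : successes X w n.+1 = false.
  have := Bw n.+1; rewrite /B /= eqxx => Xn1; apply/negbTE/eqP; apply: Xn1.
  by lia.
apply/waiting_timeP; split.
  split=> [|i im]; first by lia.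
  by have := Bw i; rewrite /B /=; case: eqP => [|_ Xi]; [lia|apply/eqP/Xi; lia].
move=> m [km mw]; rewrite leqNgt; apply/negP => mlt.
have [mn|nm] := leqP m n; first exact: (nn m mn).
(* A run of length [k] ending after [n] but before [n + k.+1] must contain the failed trial
   [n.+1]. *)
by have := mw n.+1; rewrite fail => /(_ _)/notF; apply; lia.
Qed.

End WaitingTime.

(** * Monomial shifts and the two denominators *)

Lemma coef_fps_mulXn (R : comNzRingType) (f : fps R) (a : R) m n :
  fps_coef (f * fps_of_poly (a *: 'X^m)) n =
  if (n < m)%N then 0 else a * fps_coef f (n - m).
Proof.
rewrite /=; case: ltnP => nm.
  rewrite big1// => i _; rewrite coefZ coefXn.
  by case: eqP => [|_]; rewrite ?mulr0//; lia.
have nmn : (n - m < n.+1)%N by lia.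
rewrite (bigD1 (Ordinal nmn))//= big1 => [|i /eqP im].
  by rewrite coefZ coefXn subKn// eqxx mulr1 mulrC addr0.
rewrite coefZ coefXn; case: eqP => [nim|_]; last by rewrite !mulr0.
by case: im; apply/val_inj => /=; have := ltn_ord i; lia.
Qed.

(** The sum is ['X] times a geometric sum in [p *: 'X], so the factor [1 - p *: 'X] makes it
    telescope. *)
Lemma mul_run_denominator (R : comNzRingType) (p : R) k :
  (1 - p *: 'X) * (1 - (1 - p) *: \sum_(1 <= i < k.+1) p ^+ (i - 1) *: 'X^i) =
  1 - 'X + (p ^+ k * (1 - p)) *: 'X^(k.+1) :> {poly R}.
Proof.
have -> : \sum_(1 <= i < k.+1) p ^+ (i - 1) *: 'X^i =
    'X * \sum_(i < k) (p *: 'X) ^+ i :> {poly R}.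
  rewrite big_add1 big_mkord mulr_sumr; apply: eq_bigr => i _.
  by rewrite subn1 exprZn -scalerAr -exprS.
have := subrX1 (p *: 'X : {poly R}) k.
rewrite exprZn -!mul_polyC polyCM polyCB polyC1 polyC_exp exprS.
set S := \sum_(_ < _) _ => geom.
have -> : (1 - p%:P * 'X) * (1 - (1 - p%:P) * ('X * S)) =
  1 - p%:P * 'X + (1 - p%:P) * 'X * ((p%:P * 'X - 1) * S) by ring.
by rewrite -geom; ring.
Qed.

Theorem theorem2p10 (d : measure_display) (T : measurableType d)
    (R : realType) (P : probability T R) (X : nat -> {RV P >-> R})
    (p q : R) (k : nat)
    (hp : 0 < p < 1) (hq : q = 1 - p)
    (hX1 : forall i, (1 <= i)%N -> P [set w | X i w = 1] = p%:E)
    (hX0 : forall i, (1 <= i)%N -> P [set w | X i w = 0] = q%:E)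
    (hind : independent_RVs [set i | (1 <= i)%N] X)
    (hk : (1 <= k)%N) :
  pgf P (waiting_time X k) =
    fps_of_poly (p ^+ k *: 'X^k) /
    fps_of_poly (1 - q *: \sum_(1 <= i < k.+1) p ^+ (i - 1) *: 'X^i) /\
  fps_of_poly (p ^+ k *: 'X^k) /
    fps_of_poly (1 - q *: \sum_(1 <= i < k.+1) p ^+ (i - 1) *: 'X^i) =
  fps_of_poly (p ^+ k *: 'X^k - p ^+ k.+1 *: 'X^(k.+1)) /
    fps_of_poly (1 - 'X + (p ^+ k * q) *: 'X^(k.+1)).
Proof.
have unit1X (a : {poly R}) : a`_0 = 1 -> fps_of_poly a \is a GRing.unit.
  by move=> a0; rewrite fps_unitE /= a0 unitr1.
set D1 := 1 - q *: _; set D2 := 1 - 'X + _.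
have D12 : D2 = (1 - p *: 'X) * D1.
  by rewrite /D2 /D1 hq mul_run_denominator.
have uL : fps_of_poly (1 - p *: 'X) \is a GRing.unit.
  by apply: unit1X; rewrite !coefE mulr0 subr0.
have uD2 : fps_of_poly D2 \is a GRing.unit.
  by apply: unit1X; rewrite /D2 !coefE mulr0 addr0 subr0.
(* [D1] divides the invertible [D2]. *)
have uD1 : fps_of_poly D1 \is a GRing.unit.
  by move: uD2; rewrite D12 rmorphM unitrM => /andP[].
have quotE : fps_of_poly (p ^+ k *: 'X^k) / fps_of_poly D1 =
    fps_of_poly (p ^+ k *: 'X^k - p ^+ k.+1 *: 'X^(k.+1)) / fps_of_poly D2.
  rewrite (_ : _ - _ = (1 - p *: 'X) * (p ^+ k *: 'X^k)); last first.
    by rewrite mulrBl mul1r -scalerAl -scalerAr scalerA -!exprS.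
  apply: (mulIr uD2); rewrite divrK// D12 !rmorphM mulrCA divrK//.
(* Clearing [D2] leaves the coefficient identity [f n - f (n - 1) + p ^+ k * q * f (n - k.+1) = p ^+
   k * (n == k) - p ^+ k.+1 * (n == k.+1)], with terms of negative index read as 0. *)
split=> //; rewrite quotE; apply: (mulIr uD2); rewrite divrK//.
apply/fpsP => n.
have -> : D2 = 1 *: 'X^0 + (- 1) *: 'X^1 + (p ^+ k * q) *: 'X^(k.+1).
  by rewrite scale1r expr0 scaleN1r expr1.
rewrite !rmorphD !mulrDr.
have coefD (f g : fps R) m : fps_coef (f + g) m = fps_coef f m + fps_coef g m.
  by [].
rewrite !coefD !coef_fps_mulXn ltn0 subn0 mul1r [RHS]/= !coefE.
set f := fps_coef _.
have f_lt m : (m < k)%N -> f m = 0 by exact: pmf_lt.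
have f_k : f k = p ^+ k by exact: pmf_min hind.
pose S n := fine (P (successes X @^-1` no_run k n)).
have S0 : S 0%N = 1 by exact: survival0.
have fS m : f m.+1 = S m - S m.+1 by exact: pmfS.
have f_gt m : f (m + k.+1)%N = S m * (q * p ^+ k).
  by rewrite hq; exact: pmf_after hind _.
have [nk|nk|->] := ltngtP n k.
- rewrite f_lt// (_ : f (n - 1)%N = 0); last by rewrite f_lt//; lia.
  rewrite (_ : (n < k.+1)%N); last by lia.
  rewrite (_ : (n == k.+1) = false); last by lia.
  by case: ifP => _ /=; ring.
- rewrite -(subnK nk); set m := (n - k.+1)%N.
  rewrite (_ : (m + k.+1 < 1)%N = false); last by lia.
  rewrite (_ : (m + k.+1 < k.+1)%N = false); last by lia.
  rewrite addnK f_gt (_ : (m + k.+1 - 1)%N = (m + k)%N); last by lia.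
  (* At [n = k.+1] the previous coefficient is [f k], which [f_gt] does not reach, and [f 0 = 0]
     since [k] is positive. Beyond that, [f_gt] gives both [f n] and [f (n - 1)], and [fS] makes the
     three terms cancel. *)
  case: m => [|m].
    by rewrite add0n f_k f_lt// S0 eqxx exprS hq /=; ring.
  rewrite (_ : (m.+1 + k)%N = (m + k.+1)%N); last by lia.
  by rewrite f_gt fS (_ : _ == _ = false) ?exprS /=; [ring|lia].
- rewrite f_k f_lt; last by lia.
  rewrite (_ : (k < 1)%N = false); last by lia.
  by rewrite ltnSn (_ : (k == k.+1) = false) ?exprS /=; [ring|lia].
Qed.
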